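(* There are infinitely many (pairwise different, even after renaming letters) primitive injective substitutions $\eta$ whose incidence matrix has Perron-Frobenius eigenvalue equal to the golden mean $\Phi=(1+\sqrt5)/2$ and such that the dynamical system $(X_\eta,\sigma)$ is topologically isomorphic (conjugate) to the Fibonacci system $(X_\varphi,\sigma)$.
   Context: A substitution $\theta$ on a finite alphabet $A$ is a map from $A$ to non-empty finite words over $A$, extended to words and sequences by concatenation. Its incidence matrix $M_\theta$ has entries $(M_\theta)_{a,b}=$ number of occurrences of $b$ in $\theta(a)$. $\theta$ is primitive if for some $k\ge1$ every letter occurs in $\theta^k(a)$ for all $a\in A$. $\theta$ is injective if $\theta(a)\neq\theta(b)$ for all letters $a\ne b$. The language $\mathcal L_\theta$ of a primitive $\theta$ is the set of finite words occurring in some $\theta^k(a)$, $k\ge 1$, $a\in A$; $X_\theta\subset A^{\mathbb Z}$ is the set of two-sided sequences all of whose finite subwords lie in $\mathcal L_\theta$, and $\sigma$ is the left shift. The Fibonacci substitution is $\varphi:0\mapsto 01,\ 1\mapsto 0$ on $\{0,1\}$. Two subshifts $(X,\sigma),(Y,\sigma)$ are topologically isomorphic (conjugate) if there is a homeomorphism $\psi:X\to Y$ with $\psi\sigma=\sigma\psi$. *)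

(* Defs.v *)
From HB Require Import structures.
From mathcomp Require Import all_boot all_order all_algebra all_field.
From mathcomp Require Import all_classical topology.

Set Implicit Arguments.
Unset Strict Implicit.
Unset Printing Implicit Defensive.

Import Order.TTheory GRing.Theory Num.Theory.

Local Open Scope classical_set_scope.
Local Open Scope ring_scope.

Record substitution (A : finType) := Substitution {
  subst_fun :> A -> seq A;
  subst_nonempty : forall a, subst_fun a != [::]
}.

Section Substitutions.
Variables (A : finType) (theta : substitution A).

Definition subst_word (w : seq A) : seq A := flatten [seq theta a | a <- w].

Definition subst_iter (k : nat) (a : A) : seq A := iter k subst_word [:: a].

(* Letters are numbered by [enum_val]; spectra do not depend on the numbering. *)
Definition incidence_matrix : 'M[nat]_#|A| :=
  \matrix_(i, j) count_mem (enum_val j) (theta (enum_val i)).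

Definition primitive_subst : Prop :=
  exists2 k : nat, (1 <= k)%N & forall a b : A, b \in subst_iter k a.

Definition injective_subst : Prop := injective theta.

Definition language : set (seq A) :=
  [set w | exists k a, (1 <= k)%N /\ infix w (subst_iter k a)].

End Substitutions.

Definition full_shift (A : finType) : Type :=
  {ptws int -> discrete_topology A}.

HB.instance Definition _ (A : finType) := Topological.on (full_shift A).

Definition shift (A : finType) (x : full_shift A) : full_shift A :=
  fun i => x (i + 1).

(* The word x_i x_(i+1) ... x_(i+n-1). *)
Definition window (A : finType) (x : full_shift A) (i : int) (n : nat) :
    seq A :=
  [seq x (i + j%:Z) | j <- iota 0 n].

Definition subshift (A : finType) (theta : substitution A) :
    set (full_shift A) :=
  [set x | forall i n, language theta (window x i n)].

Lemma shift_subshift (A : finType) (theta : substitution A) x :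
  x \in subshift theta -> shift x \in subshift theta.
Proof.
rewrite !inE => Xx i n.
have -> : window (shift x) i n = window x (i + 1) n.
  by apply: eq_map => j; rewrite /shift addrAC.
exact: Xx.
Qed.

Definition subshift_map (A : finType) (theta : substitution A)
    (x : subshift theta) : subshift theta :=
  exist _ (shift (val x)) (shift_subshift (valP x)).

Definition homeomorphism (X Y : topologicalType) (f : X -> Y) : Prop :=
  continuous f /\
  exists g : Y -> X, [/\ cancel f g, cancel g f & continuous g].

Definition topologically_conjugate (X Y : topologicalType)
    (S : X -> X) (T : Y -> Y) : Prop :=
  exists psi : X -> Y, homeomorphism psi /\ (forall x, psi (S x) = T (psi x)).

(* A letter-to-letter bijection carrying one substitution to the other. *)
Definition equal_up_to_renaming (A B : finType)
    (theta : substitution A) (eta : substitution B) : Prop :=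
  exists2 f : A -> B, bijective f & forall a, eta (f a) = map f (theta a).

(* The dominant eigenvalue.  For integer matrices, quantifying over eigenvalues
   in [algC] accounts for all complex eigenvalues, since these are algebraic. *)
Definition Perron_Frobenius_eigenvalue n (M : 'M[nat]_n) (lam : algC) : Prop :=
  let MC : 'M[algC]_n := map_mx (fun m : nat => m%:R) M in
  [/\ 0 < lam, eigenvalue MC lam
    & forall mu, eigenvalue MC mu -> mu != lam -> `|mu| < lam].

Definition golden_mean : algC := (1 + sqrtC 5) / 2.

Definition fibonacci_fun (a : 'I_2) : seq 'I_2 :=
  if a == 0 then [:: 0; 1] else [:: 0].

Lemma fibonacci_nonempty a : fibonacci_fun a != [::].
Proof. by rewrite /fibonacci_fun; case: ifP. Qed.

Definition fibonacci : substitution 'I_2 := Substitution fibonacci_nonempty.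

(* Main.v *)
(* For 0 < b <= a, let W(0) = 0 1 .. a-1 and W(1) = a .. a+b-1 be words over a+b
   distinct letters.  Any way of cutting W(0)W(1) into a pieces and W(0) into b
   pieces gives a substitution with W(0) |-> W(0)W(1) and W(1) |-> W(0), whose
   subshift is the Fibonacci subshift with 0, 1 replaced by W(0), W(1).  When
   (a, b) is a pair of consecutive Fibonacci numbers this is a tower
   representation of the Fibonacci system itself: reducing letters modulo a+b
   carries the system of (a+b, a) onto that of (a, b), and looking ahead to the
   beginning of the next block inverts this.  The pair (1, 1) gives the Fibonacci
   substitution.

   The cut used in [tower a b] leaves all but one piece in each word of length 1,
   so that the image of p always contains p + b mod a+b.  As a and b are coprime,
   this rotation is transitive, which yields primitivity.  The increments of an
   eigenvector inside W(0) and W(1) are carried along the same rotation until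
   they are annihilated at b-1, so that the nonzero spectrum is that of the
   Fibonacci matrix. *)

Require Import Defs.
From mathcomp Require Import all_boot all_order all_algebra all_field.
From mathcomp Require Import zify ring.
From mathcomp Require Import all_classical topology.

Set Implicit Arguments.
Unset Strict Implicit.
Unset Printing Implicit Defensive.

Import Order.TTheory GRing.Theory Num.Theory.

(** * Rotations modulo [n] and factors of words *)

Lemma coprime_mul_surj h n q : coprime h n -> q < n ->
  exists2 t, t < n & (t * h) %% n = q.
Proof.
suff ex : coprime h n -> q < n -> exists t, (t * h) %% n = q.
  move=> cop lt_qn; have [t tq] := ex cop lt_qn.
  by exists (t %% n); rewrite ?modnMml ?ltn_mod //; lia.
move=> cop lt_qn; have n_gt0 : 0 < n by lia.
case: (posnP h) => [h0|h_gt0].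
  exists 0; move: cop; rewrite h0 /coprime gcd0n => /eqP n1.
  by rewrite mul0n; lia.
have [u v e _] := egcdnP n h_gt0.
exists (q * u); rewrite -mulnA e (eqP cop) mulnDr muln1 mulnA modnMDl.
exact: modn_small.
Qed.

(** Induction along the orbit of [q0] under adding [h] modulo [n]; by coprimality this orbit is
    everything. *)
Lemma rotation_ind h n q0 (P : nat -> Prop) : coprime h n -> q0 < n ->
    P q0 -> (forall q, q < n -> P q -> P ((q + h) %% n)) ->
  forall q, q < n -> P q.
Proof.
move=> cop lt0 P0 PS q ltq.
have Pt t : P ((q0 + t * h) %% n).
  elim: t => [|t IHt]; first by rewrite addn0 modn_small.
  rewrite mulSn addnCA addnC -modnDml; apply: PS => //; rewrite ltn_mod; lia.
have [t _ te] := @coprime_mul_surj h n ((q + n - q0) %% n) cop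
  (ltn_pmod _ (leq_ltn_trans (leq0n _) lt0)).
have := Pt t; rewrite -modnDmr te modnDmr subnKC; last lia.
by rewrite modnDr modn_small.
Qed.

Lemma infix_map_inj (T1 T2 : eqType) (f : T1 -> T2) u v :
  injective f -> infix (map f u) (map f v) = infix u v.
Proof.
move=> f_inj; apply/idP/idP => [|/infixP[x [y ->]]]; last first.
  by rewrite !map_cat infix_infix.
move=> /infixP[x [y e]]; apply/infixP.
exists (take (size x) v), (drop (size x + size u) v).
apply: (inj_map f_inj); rewrite !map_cat map_take map_drop e.
rewrite take_size_cat // -(size_map f u) -[size x + _]size_cat.
by rewrite [x ++ _ ++ y in RHS]catA drop_size_cat.
Qed.

Lemma prefix_iota m n s : m <= n -> prefix (iota s m) (iota s n).
Proof. by move=> le_mn; rewrite -(subnKC le_mn) iotaD prefix_prefix. Qed.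

(** * The tower substitution on words of natural numbers *)

Section Words.
Variables a b : nat.

(** The cut of W(0)W(1) has its long piece, of length [b.+1], first; the cut of W(0) has its long
    piece, of length [(a - b).+1], last. *)
Definition letter_image (p : nat) : seq nat :=
  if p == 0 then iota 0 b.+1
  else if p < a then [:: p + b]
  else if p < (a + b).-1 then [:: p - a]
  else iota b.-1 (a - b).+1.

Definition word_image (w : seq nat) : seq nat := flatten (map letter_image w).

Definition fib_word (k : nat) : seq nat := iter k word_image (iota 0 a).

(* The successor relation inside sequences of blocks [0 .. a - 1] and
   [a .. a + b - 1]. *)
Definition block_end (p : nat) : bool := (p == a.-1) || (p == (a + b).-1).

Definition block_step (p q : nat) : bool :=
  if block_end p then (q == 0) || (q == a) else q == p.+1.

Hypotheses (b_gt0 : 0 < b) (le_ba : b <= a).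

Lemma letter_image_neq0 p : letter_image p != [::].
Proof. by rewrite /letter_image; do !case: ifP. Qed.

Lemma letter_image_lt p q : p < a + b -> q \in letter_image p -> q < a + b.
Proof.
move=> ltp; rewrite /letter_image; do !case: ifP => ?;
  rewrite ?mem_iota ?mem_seq1; lia.
Qed.

Lemma word_image_cat u v : word_image (u ++ v) = word_image u ++ word_image v.
Proof. by rewrite /word_image map_cat flatten_cat. Qed.

Lemma word_image_iter_cat k u v :
  iter k word_image (u ++ v) = iter k word_image u ++ iter k word_image v.
Proof. by elim: k => //= k ->; rewrite word_image_cat. Qed.

Lemma mem_word_image p q w :
  q \in letter_image p -> p \in w -> q \in word_image w.
Proof. by move=> qp pw; apply/flatten_mapP; exists p. Qed.

Lemma infix_word_image k u v :
  infix u v -> infix (iter k word_image u) (iter k word_image v).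
Proof.
by case/infixP=> [x [y ->]]; rewrite !word_image_iter_cat infix_infix.
Qed.

Lemma word_image_iota s n d :
    (forall i, i < n -> letter_image (s + i) = [:: d + i]) ->
  word_image (iota s n) = iota d n.
Proof.
elim: n s d => //= n IHn s d im; rewrite /word_image /= -/(word_image _).
have := im 0 isT; rewrite !addn0 => ->; congr (_ :: _).
by apply: IHn => i lt_in; rewrite !addSnnS; apply: im.
Qed.

(** Inside the first block only [0] can have an image longer than one letter, so a non-empty prefix
    gains exactly [b] letters. *)
Lemma word_image_prefix c :
  0 < c <= a -> word_image (iota 0 c) = iota 0 (b + c).
Proof.
case/andP=> c0 ca; have -> : iota 0 c = 0 :: iota 1 c.-1.
  by rewrite -[in LHS](prednK c0).
rewrite -cat1s word_image_cat (@word_image_iota 1 c.-1 b.+1); last first.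
  move=> i ltic; rewrite /letter_image.
  by do !case: ifP => ?; (try congr cons); lia.
have -> : word_image [:: 0] = iota 0 b.+1 by rewrite /word_image /= cats0.
by rewrite -[b.+1]add0n -iotaD; congr iota; lia.
Qed.

Lemma word_image_block0 : word_image (iota 0 a) = iota 0 (a + b).
Proof. by rewrite [a + b]addnC word_image_prefix //; lia. Qed.

Lemma word_image_block1 : word_image (iota a b) = iota 0 a.
Proof.
have {1}-> : b = b.-1 + 1 by lia.
rewrite iotaD word_image_cat (@word_image_iota a b.-1 0); last first.
  move=> i ltib; rewrite /letter_image.
  by do !case: ifP => ?; (try congr cons); lia.
have -> : word_image [:: a + b.-1] = iota b.-1 (a - b).+1.
  by rewrite /word_image /= cats0 /letter_image; do !case: ifP => ? //; lia.
by rewrite -{2}[b.-1]add0n -iotaD; congr iota; lia.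
Qed.

Lemma fib_word1 : fib_word 1 = iota 0 (a + b).
Proof. exact: word_image_block0. Qed.

(** Two applications turn W(0) into W(0)W(1)W(0), which is [fib_word 1] followed by [fib_word 0];
    the remaining [k] applications respect concatenation. *)
Lemma fib_wordSS k : fib_word k.+2 = fib_word k.+1 ++ fib_word k.
Proof.
rewrite /fib_word !iterSr word_image_block0 [in LHS]iotaD add0n word_image_cat.
by rewrite word_image_block0 word_image_block1 word_image_iter_cat.
Qed.

Lemma infix_fib_wordS k : infix (fib_word k) (fib_word k.+1).
Proof.
case: k => [|k]; last by rewrite fib_wordSS prefix_infix.
by rewrite fib_word1 iotaD prefix_infix.
Qed.

Lemma fib_word_lt k q : q \in fib_word k -> q < a + b.
Proof.
elim: k q => [|k IHk] q; first by rewrite mem_iota; lia.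
by case/flatten_mapP=> p /IHk; apply: letter_image_lt.
Qed.

Lemma path_block_step_iota p n :
  (forall q, p <= q < p + n -> ~~ block_end q) ->
  path block_step p (iota p.+1 n).
Proof.
elim: n p => //= n IHn p noend; rewrite IHn ?andbT /block_step.
  by rewrite (negPf (noend p _)) ?eqxx //; lia.
by move=> q qn; apply: noend; lia.
Qed.

Lemma path_block_step_block p s n : block_end p -> (s == 0) || (s == a) ->
    0 < n -> (forall q, s <= q < s + n -> block_end q = (q == (s + n).-1)) ->
  path block_step p (iota s n) && block_end (last p (iota s n)).
Proof.
move=> pe se; case: n => // n _ ends; apply/andP; split.
  rewrite /= path_block_step_iota /block_step ?pe ?se // => q sq.
  by rewrite ends; lia.
have -> : last p (iota s n.+1) = s + n.
  by rewrite -[n.+1]addn1 iotaD last_cat.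
by rewrite ends; lia.
Qed.

(** Starting after a block end and finishing at one makes the invariant stable under concatenation,
    so it follows the Fibonacci recursion. *)
Lemma path_fib_word k p : block_end p ->
  path block_step p (fib_word k) && block_end (last p (fib_word k)).
Proof.
have P0 p' : block_end p' ->
    path block_step p' (iota 0 a) && block_end (last p' (iota 0 a)).
  by move=> pe; apply: path_block_step_block => //; rewrite /block_end; lia.
have P1 p' : block_end p' ->
    path block_step p' (iota a b) && block_end (last p' (iota a b)).
  by move=> pe; apply: path_block_step_block => //; rewrite /block_end; lia.
elim/ltn_ind: k p => -[|[|k]] IHk p pe; first exact: P0.
  rewrite fib_word1 iotaD cat_path last_cat add0n.
  by have /andP[-> /P1/andP[-> ->]] := P0 p pe.
rewrite fib_wordSS cat_path last_cat.
have /andP[-> e1] := IHk k.+1 (ltnSn _) p pe; exact: IHk.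
Qed.

Lemma sorted_fib_word k : sorted block_step (fib_word k).
Proof.
have e0 : block_end a.-1 by rewrite /block_end eqxx.
by have /andP[/path_sorted] := path_fib_word k e0.
Qed.

End Words.

(** * Language, primitivity and injectivity of the tower substitution *)

Section Substitution.
Variables a b : nat.

Definition tower_fun (p : 'I_(a + b).-1.+1) : seq 'I_(a + b).-1.+1 :=
  map inord (letter_image a b p).

Lemma tower_nonempty p : tower_fun p != [::].
Proof.
by have := letter_image_neq0 a b p; rewrite -!size_eq0 size_map.
Qed.

Definition tower := Substitution tower_nonempty.

Hypotheses (b_gt0 : 0 < b) (le_ba : b <= a).

Lemma ltn_letter (p : 'I_(a + b).-1.+1) : p < a + b.
Proof. by have := ltn_ord p; lia. Qed.

Lemma val_tower p : map val (tower p) = letter_image a b p.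
Proof.
rewrite -map_comp map_id_in // => q qp /=; apply: inordK.
by have := letter_image_lt b_gt0 le_ba (ltn_letter p) qp; lia.
Qed.

Lemma val_subst_word w :
  map val (subst_word tower w) = word_image a b (map val w).
Proof.
rewrite /subst_word /word_image map_flatten -!map_comp; congr flatten.
by apply: eq_map => p /=; rewrite val_tower.
Qed.

Lemma val_subst_iter k p :
  map val (subst_iter tower k p) = iter k (word_image a b) [:: val p].
Proof.
rewrite /subst_iter; elim: k => //= k IHk.
by rewrite val_subst_word IHk.
Qed.

(** Each application lengthens the known prefix by at least one letter, until the whole first block
    is reached. *)
Lemma prefix_iter_word_image m :
  prefix (iota 0 (minn a m.+1)) (iter m (word_image a b) [:: 0]).
Proof.
elim: m => [|m IHm]; first by rewrite (_ : minn a 1 = 1) //; lia.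
case/prefixP: IHm => s e; rewrite iterS e word_image_cat.
rewrite word_image_prefix //; last lia.
by apply/prefix_catl/prefix_iota; lia.
Qed.

Lemma infix_iter_word_image m : a <= m ->
  infix (iota 0 a) (iter m (word_image a b) [:: 0]).
Proof.
move=> le_am; apply: prefixW.
by have := prefix_iter_word_image m; rewrite (_ : minn a m.+1 = a) //; lia.
Qed.

(** Every letter occurs in W(0)W(1), which is [fib_word 1]; conversely W(0) occurs in a high iterate
    of the letter [0]. *)
Lemma tower_languageP w :
  language tower w <-> exists k, infix (map val w) (fib_word a b k).
Proof.
split=> [[k [p [_]]]|[k wk]].
  rewrite -(infix_map_inj _ _ val_inj) val_subst_iter => wk; exists k.+1.
  apply: infix_trans wk _; rewrite /fib_word iterSr; apply: infix_word_image.
  rewrite word_image_block0 //.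
  have := cat_take_drop p (iota 0 (a + b)); rewrite take_iota drop_iota.
  have -> : a + b - p = 1 + (a + b - p.+1) by have := ltn_letter p; lia.
  by rewrite iotaD => <-; rewrite infix_infix.
exists (k + a.+1), ord0; split; first lia.
rewrite -(infix_map_inj _ _ val_inj) val_subst_iter iterD.
by apply: infix_trans wk _; apply/infix_word_image/infix_iter_word_image.
Qed.

Lemma rotation_mem p : p < a + b -> (p + b) %% (a + b) \in letter_image a b p.
Proof.
move=> ltp; have e : (p + b) %% (a + b) = if p < a then p + b else p - a.
  case: ltnP => pa; first by rewrite modn_small //; lia.
  by rewrite (_ : p + b = p - a + (a + b)) ?modnDr ?modn_small //; lia.
rewrite e /letter_image; do !case: ifP => ?; rewrite ?mem_iota ?mem_seq1; lia.
Qed.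

Lemma rotation_iter_mem p t : p < a + b ->
  (p + t * b) %% (a + b) \in iter t (word_image a b) [:: p].
Proof.
move=> ltp; elim: t => [|t IHt] /=.
  by rewrite addn0 modn_small // mem_seq1.
apply: mem_word_image IHt; rewrite mulSn addnCA addnC -modnDml.
by apply: rotation_mem; rewrite ltn_mod; lia.
Qed.

Lemma mem_iter_word_image t p q w : q \in iter t (word_image a b) [:: p] ->
  p \in w -> q \in iter t (word_image a b) w.
Proof.
move=> qp /splitPr[u v]; rewrite -cat1s !word_image_iter_cat !mem_cat qp.
by rewrite orbT.
Qed.

Lemma tower_primitive : coprime a b -> primitive_subst tower.
Proof.
(* Fewer than [a + b] rotation steps lead from [p] to [0], at least [a] further steps produce W(0),
   and a last one gives W(0)W(1), which contains every letter. *)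
move=> cop; exists (a + b + a.+1) => [|p q]; first lia.
have [] := @coprime_mul_surj b (a + b) ((a + b - p) %% (a + b)).
- by rewrite /coprime gcdnDr gcdnC.
- by rewrite ltn_mod; lia.
move=> t ltt te.
have ltp := ltn_letter p; have := rotation_iter_mem t ltp.
rewrite -modnDmr te modnDmr subnKC 1?ltnW // modnn => p0.
rewrite -(mem_map val_inj) val_subst_iter.
have -> : a + b + a.+1 = (a + b - t + a).+1 + t by lia.
rewrite iterD; apply: mem_iter_word_image p0.
have /infixP[x [y e]] := @infix_iter_word_image (a + b - t + a) (leq_addl _ _).
rewrite iterS e !word_image_cat word_image_block0 // !mem_cat mem_iota.
by rewrite ltn_letter !orbT.
Qed.

(** Only the images of [0] and [a] begin with the same letter; as [1 < b], their lengths are [b.+1]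
    and 1. *)
Lemma tower_injective : 1 < b -> injective_subst tower.
Proof.
move=> b_gt1 p q /(congr1 (map val)); rewrite !val_tower => e.
apply: ord_inj.
have := congr1 (head 0) e; have := congr1 size e; rewrite /letter_image.
have := ltn_letter p; have := ltn_letter q.
by do !case: ifP => ?; rewrite /= ?size_iota; lia.
Qed.

End Substitution.

(** * The spectrum of the incidence matrix *)

Section Eigenvalues.
Local Open Scope ring_scope.

(** Eigenvectors are row vectors here, so the equation at [q] sums over the letters [p] whose images
    contain [q]. *)
Lemma eigenvalue_incidenceP (A : finType) (theta : substitution A)
    (mu : algC) :
  eigenvalue (map_mx (fun m : nat => m%:R) (incidence_matrix theta)) mu <->
  exists2 f : A -> algC, (exists p, f p != 0) &
    forall q, \sum_p f p *+ count_mem q (theta p) = mu * f q.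
Proof.
split=> [/eigenvalueP[v vM v0]|[f [p fp] fM]].
  exists (fun p => v 0 (enum_rank p)).
    move: v0; apply: contra_neqP => /forallNP v0; apply/rowP => i.
    by apply/eqP/negPn/negP; rewrite mxE -(enum_valK i); exact: v0.
  move=> q; have := congr1 (fun w : 'rV_#|A| => w 0 (enum_rank q)) vM.
  rewrite !mxE => <-; rewrite (reindex_onto enum_rank enum_val) /=; last first.
    by move=> i _; rewrite enum_valK.
  apply: eq_big => [p|p _]; first by rewrite enum_rankK eqxx.
  by rewrite !mxE !enum_rankK mulr_natr.
apply/eigenvalueP; exists (\row_i f (enum_val i)); last first.
  apply: contra_neq fp => /rowP/(_ (enum_rank p)).
  by rewrite !mxE enum_rankK.
apply/rowP => j; rewrite !mxE -fM.
rewrite (reindex_onto enum_rank enum_val) /=; last first.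
  by move=> i _; rewrite enum_valK.
apply: eq_big => [q|q _]; first by rewrite enum_rankK eqxx.
by rewrite !mxE !enum_rankK mulr_natr.
Qed.

Lemma golden_meanE : golden_mean ^+ 2 = golden_mean + 1.
Proof.
rewrite /golden_mean; have s5 : sqrtC (5 : algC) ^+ 2 = 5 by rewrite sqrtCK.
by field: s5.
Qed.

Lemma golden_mean_gt1 : 1 < golden_mean.
Proof.
have s5 : 1 < sqrtC (5 : algC).
  by rewrite -{1}sqrtC1 ltr_sqrtC ?qualifE /= ?ler0n ?ltr1n.
by rewrite /golden_mean ltr_pdivlMr ?ltr0n // mul1r -[2%:R]/(1 + 1) ltrD2l.
Qed.

(** The other root is one minus the golden mean, of absolute value golden mean minus one. *)
Lemma golden_root (mu : algC) : mu ^+ 2 = mu + 1 -> mu != golden_mean ->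
  `|mu| < golden_mean.
Proof.
move=> mu2 neq; have := golden_meanE; have := golden_mean_gt1.
move: golden_mean neq => g neq g1 g2.
have : (mu - g) * (mu - (1 - g)) == 0 by apply/eqP; ring: mu2 g2.
rewrite mulf_eq0 !subr_eq0 (negPf neq) => /eqP ->.
rewrite distrC ger0_norm ?subr_ge0 ?ltW // ltrBlDr ltrDl ltr01 //.
Qed.

Variables a b : nat.
Hypotheses (b_gt0 : (0 < b)%N) (le_ba : (b <= a)%N).

(** The first summand locates [q] in the cut of W(0)W(1), the second in the cut of W(0). Truncated
    subtraction sends all [q <= b] to the long piece of [0]; [minn] sends all [q >= b.-1] to that of
    the last letter. *)
Lemma count_letter_image p q : (p < a + b)%N ->
  count_mem q (letter_image a b p) =
  ((q < a + b) && (p == q - b) + ((q < a) && (p == a + minn q b.-1)))%N.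
Proof.
move=> ltp; rewrite /letter_image; do !case: ifP => ?;
  rewrite ?count_uniq_mem ?iota_uniq // ?mem_iota ?mem_seq1; lia.
Qed.

Lemma sum_count_letter_image (f : nat -> algC) q : (q < a + b)%N ->
  \sum_(p < (a + b).-1.+1) f p *+ count_mem q (letter_image a b p) =
  f (q - b)%N + (if (q < a)%N then f (a + minn q b.-1)%N else 0).
Proof.
move=> ltq; have delta r : (r < a + b)%N ->
    \sum_(p < (a + b).-1.+1) f p *+ (nat_of_ord p == r) = f r.
  move=> ltr; have r_lt : (r < (a + b).-1.+1)%N by lia.
  rewrite (bigD1 (Ordinal r_lt)) //= eqxx big1 ?addr0 // => i.
  by rewrite -val_eqE /= => /negPf ->.
under eq_bigr => p _.
  rewrite count_letter_image ?ltn_letter // ltq andTb mulrnDr; over.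
rewrite big_split /= delta; last lia; congr (_ + _).
case: ltnP => qa; last by apply: big1.
by rewrite delta //; lia.
Qed.

Lemma tower_eigenvalueP (mu : algC) :
  eigenvalue (map_mx (fun m : nat => m%:R) (incidence_matrix (tower a b))) mu
  <-> exists2 f : nat -> algC, (exists2 p, (p < a + b)%N & f p != 0) &
    forall q, (q < a + b)%N -> mu * f q =
      f (q - b)%N + (if (q < a)%N then f (a + minn q b.-1)%N else 0).
Proof.
have countE p q : count_mem q (tower a b p) =
    count_mem (val q) (letter_image a b p).
  rewrite -[in RHS]val_tower // [RHS]count_map; apply: eq_count => r.
  by rewrite /= (inj_eq val_inj).
rewrite eigenvalue_incidenceP; split=> -[f [p fp]].
  move=> fM; exists (fun i => f (inord i)).
    by exists p; rewrite ?ltn_letter ?inord_val.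
  move=> q ltq; rewrite -(sum_count_letter_image (fun i => f (inord i))) //.
  rewrite -fM; apply: eq_bigr => r _.
  by rewrite inord_val countE /= inordK //; lia.
move=> fp0 fM; exists (fun i => f (val i)).
  by exists (inord p); rewrite /= inordK //; lia.
move=> q; rewrite fM ?ltn_letter // -sum_count_letter_image ?ltn_letter //.
by apply: eq_bigr => r _; rewrite countE.
Qed.

(* The increments of an eigenvector inside the two blocks are carried along the
   rotation by [b], and the eigenvalue equation kills the one at [b - 1]. *)
Lemma eigenvector_increment0 (mu : algC) (f : nat -> algC) : coprime a b ->
    mu != 0 ->
    (forall q, (q < a + b)%N -> mu * f q =
      f (q - b)%N + (if (q < a)%N then f (a + minn q b.-1)%N else 0)) ->
  forall q, (q.+1 < a + b)%N -> q.+1 != a -> f q.+1 = f q.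
Proof.
move=> cop mu0 fM.
(* Both [b.-1] and [b] lie in the long image of [0] and in that of the last letter, so their
   equations have equal right-hand sides. *)
have start : (b.-1.+1 < a + b)%N -> b.-1.+1 != a -> f b.-1.+1 = f b.-1.
  rewrite prednK // => ltb ba; apply: (mulfI mu0); rewrite !fM; try lia.
  rewrite !ifT; try lia; congr (f _ + f _); lia.
move=> q lts; have ltq := ltnW lts; move: q ltq lts.
apply: (@rotation_ind b (a + b)%N b.-1
  (fun q => (q.+1 < a + b)%N -> q.+1 != a -> f q.+1 = f q)) => //; try lia.
  by rewrite /coprime gcdnDr gcdnC.
(* The equations for the rotated letter and its successor share one term: the contribution of W(0)
   if [q < a], the value at [0] otherwise. The other terms agree by [IHq]. *)
move=> q; case: (ltnP q a) => qa ltq IHq.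
  rewrite modn_small; last lia.
  move=> lts sa; apply: (mulfI mu0); rewrite !fM; try lia.
  rewrite -addSn !addnK IHq; try lia; congr (_ + _).
  case: ifP => ?; case: ifP => ?; try lia; last by [].
  congr f; lia.
rewrite (_ : q + b = q - a + (a + b))%N; last lia.
rewrite modnDr modn_small; last lia.
case: (eqVneq (q - a)%N b.-1) => [-> //|qb] lts sa.
apply: (mulfI mu0); rewrite !fM; try lia.
rewrite !ifT; try lia; congr (_ + _); first by congr f; lia.
rewrite (_ : a + _ = q.+1)%N; last lia.
rewrite (_ : a + _ = q)%N; last lia.
apply: IHq; lia.
Qed.

Lemma tower_Perron_Frobenius : coprime a b ->
  Perron_Frobenius_eigenvalue (incidence_matrix (tower a b)) golden_mean.
Proof.
move=> cop; have g1 := golden_mean_gt1; have g2 := golden_meanE.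
split=> [||mu].
- exact: lt_trans ltr01 g1.
- apply/tower_eigenvalueP.
  exists (fun p => if (p < a)%N then golden_mean else 1).
    by exists 0%N; [lia | rewrite ifT ?gt_eqF ?(lt_trans ltr01) //; lia].
  move=> q ltq; case: ltnP => qa.
    rewrite -expr2 g2 ifT ?ifF //; lia.
  rewrite mulr1 addr0 ifT //; lia.
case: (eqVneq mu 0) => [-> _ _|mu0].
  by rewrite normr0 (lt_trans ltr01).
move=> /tower_eigenvalueP[f [p ltp fp] fM]; apply: golden_root.
have inc := eigenvector_increment0 cop mu0 fM.
have f0 i : (i < a)%N -> f i = f 0%N.
  by elim: i => // i IHi lti; rewrite inc ?IHi //; lia.
have f1 i : (i < b)%N -> f (a + i)%N = f a.
  elim: i => [|i IHi] lti; first by rewrite addn0.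
  by rewrite addnS inc ?IHi //; lia.
(* Being constant on blocks, [f] reduces to a pair of values satisfying the eigenvalue equations of
   the Fibonacci matrix. *)
have e0 : mu * f 0%N = f 0%N + f a.
  by rewrite fM ?(ifT, sub0n, min0n, addn0) //; lia.
have e1 : mu * f a = f 0%N.
  by rewrite fM ?ifF ?addr0 ?f0 //; lia.
have fa0 : f a != 0.
  apply: contra_neq fp => fa0; case: (ltnP p a) => [pa|ap].
    by rewrite f0 // -e1 fa0 mulr0.
  by rewrite -(subnKC ap) f1 //; lia.
apply: (mulIf fa0); rewrite mulrDl mul1r expr2 -mulrA e1 e0; ring.
Qed.

End Eigenvalues.

(** * Topology of subshifts and conjugacy *)

Section Conjugacy.
Local Open Scope ring_scope.
Local Open Scope classical_set_scope.

Lemma near_letter (A : finType) (theta : substitution A)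
    (x : subshift theta) (i : int) :
  \forall y \near x, (val y : full_shift A) i = (val x : full_shift A) i.
Proof.
pose pr (y : full_shift A) : discrete_topology A := y i.
have cv : continuous (fun y : subshift theta => pr (val y)).
  move=> y; have cv : continuous (val : subshift theta -> full_shift A).
    exact: initial_continuous.
  have cpr : continuous pr.
    exact: (@proj_continuous int (fun=> discrete_topology A) i).
  exact: continuous_comp (cv y) (cpr _).
exact: (cv x _ (discrete_set1 (pr (val x)))).
Qed.

(** The topology is induced from a product of discrete spaces, so locally constant coordinates
    suffice. *)
Lemma continuous_subshift (A B : finType) (theta : substitution A)
    (eta : substitution B) (psi : subshift theta -> subshift eta) :
  (forall (x : subshift theta) (i : int), \forall y \near x,
     (val (psi y) : full_shift B) i = (val (psi x) : full_shift B) i) ->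
  continuous psi.
Proof.
move=> near_psi; apply: continuous_comp_initial => x.
apply/cvg_sup; first exact/fmap_filter/nbhs_filter.
move=> i U [_ [[V _ <-] /= Vx]] /filterS; apply.
  exact/fmap_filter/nbhs_filter.
apply: filterS (near_psi x i) => y e.
by have : V ((val (psi y) : full_shift B) i) by rewrite e.
Qed.

Lemma conjugate_refl (X : topologicalType) (S : X -> X) :
  topologically_conjugate S S.
Proof.
exists id; split=> //; split; first by move=> x.
by exists id; split=> // x.
Qed.

Lemma conjugate_trans (X Y Z : topologicalType) (S : X -> X) (T : Y -> Y)
    (U : Z -> Z) :
  topologically_conjugate S T -> topologically_conjugate T U ->
  topologically_conjugate S U.
Proof.
move=> [f [[cf [f' [fK f'K cf']]] fS]] [g [[cg [g' [gK g'K cg']]] gT]].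
exists (g \o f); split; last by move=> x /=; rewrite fS gT.
split; first by move=> x; apply: continuous_comp; [exact: cf | exact: cg].
exists (f' \o g'); split; [exact: can_comp | exact: can_comp |].
by move=> x; apply: continuous_comp; [exact: cg' | exact: cf'].
Qed.

End Conjugacy.

(** * Reduction modulo [a + b] and its inverse on letters *)

Section Recoding.
Variables a b : nat.
Hypotheses (b_gt0 : 0 < b) (le_ba : b <= a).

(** Modulo [a + b] the blocks of [(a + b, a)] become W(0)W(1) and W(0), that is [fib_word 1] and
    [fib_word 0]; hence the index shift, and both sides obey the same recursion. *)
Lemma map_mod_fib_word k :
  map (modn^~ (a + b)) (fib_word (a + b) a k) = fib_word a b k.+1.
Proof.
have a_gt0 : 0 < a by lia.
have mod_id n : n <= a + b -> map (modn^~ (a + b)) (iota 0 n) = iota 0 n.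
  move=> len; rewrite map_id_in // => q; rewrite mem_iota => ?.
  by rewrite modn_small; lia.
elim/ltn_ind: k => -[|[|k]] IHk.
- by rewrite fib_word1 // mod_id.
- rewrite fib_wordSS // !fib_word1 ?leq_addr // [iota 0 (a + b + a)]iotaD.
  rewrite map_cat mod_id // add0n.
  congr (_ ++ _); rewrite -[X in iota X a]addn0 iotaDl -map_comp.
  rewrite -[fib_word a b 0]mod_id; last lia.
  by apply: eq_map => q /=; rewrite modnDl.
by rewrite fib_wordSS ?leq_addr // map_cat !IHk // -fib_wordSS.
Qed.

(* A letter [p < a] of the [(a, b)] coding comes from the second block of the
   [(a + b, a)] coding exactly when the next block does not start with [a],
   the letter following [a - 1] in the first block. *)
Definition decode (h : nat -> nat) : nat :=
  if (h 0 < a) && (h (a - h 0) == 0) then h 0 + (a + b) else h 0.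

Lemma decode_lt h : h 0 < a + b -> decode h < a + b + a.
Proof. by rewrite /decode; case: ifP => [/andP[]|]; lia. Qed.

Lemma decode_mod h : h 0 < a + b -> decode h %% (a + b) = h 0.
Proof.
by move=> lth; rewrite /decode; case: ifP => _; rewrite ?modnDr modn_small.
Qed.

(** Letters of [g] increase by one inside a block. If [g 0 < a], the letter at distance [a - g 0] is
    [a], with non-zero residue. If [g 0] is in the second block, the tested position starts the next
    block, with [0] or [a + b], both of residue 0. *)
Lemma decode_modn (g h : nat -> nat) :
    (forall l, l <= a -> h l = g l %% (a + b)) ->
    (forall l, l < a -> block_step (a + b) a (g l) (g l.+1)) ->
  g 0 < a + b + a -> decode h = g 0.
Proof.
move=> hg step ltg.
have run m : m <= a ->
    (forall q, g 0 <= q < g 0 + m -> ~~ block_end (a + b) a q) ->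
    g m = g 0 + m.
  elim: m => [|m IHm] lem noend; first by rewrite addn0.
  have gm : g m = g 0 + m by apply: IHm => [|q qm]; [|apply: noend]; lia.
  have := step m lem.
  by rewrite /block_step gm (negPf (noend _ _)) => [/eqP ->|]; lia.
rewrite /decode (hg 0) //; case: (ltnP (g 0) (a + b)) => g0N.
  rewrite modn_small //; case: ltnP => //= g0a.
  rewrite hg ?leq_subr // run ?leq_subr //; last first.
    by move=> q; rewrite /block_end; lia.
  by rewrite subnKC ?modn_small ?ifF //; lia.
have -> : g 0 %% (a + b) = g 0 - (a + b).
  by rewrite -{1}(subnK g0N) modnDr modn_small; lia.
rewrite (_ : g 0 - (a + b) < a) /=; last lia.
set m := a - (g 0 - (a + b)).
have gm : g m.-1 = a + b + a.-1.
  rewrite run; try lia.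
  by move=> q; rewrite /block_end; lia.
have := step m.-1; rewrite prednK; last lia.
rewrite gm /block_step ifT; last by rewrite /block_end; lia.
rewrite hg; last lia.
move=> stepm; have /orP[/eqP->|/eqP->] : (g m == 0) || (g m == a + b).
  by apply: stepm; lia.
  by rewrite mod0n eqxx; lia.
by rewrite modnn eqxx; lia.
Qed.

Local Notation N := (a + b).-1.+1.
Local Notation N' := (a + b + a).-1.+1.

Local Open Scope ring_scope.

Definition merge_blocks (x : full_shift 'I_N') : full_shift 'I_N :=
  fun i => inord (x i %% (a + b))%N.

Definition split_blocks (z : full_shift 'I_N) : full_shift 'I_N' :=
  fun i => inord (decode (fun j => z (i + j%:Z))).

Lemma val_merge_blocks x i : val (merge_blocks x i) = (x i %% (a + b))%N.
Proof.
rewrite /= inordK //.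
by have := @ltn_pmod (x i) (a + b)%N; lia.
Qed.

Lemma val_split_blocks z i :
  val (split_blocks z i) = decode (fun j => z (i + j%:Z)).
Proof.
rewrite /= inordK //.
have := @decode_lt (fun j => z (i + j%:Z)) (ltn_letter b_gt0 le_ba _); lia.
Qed.

End Recoding.

(** * Conjugacy between consecutive towers *)

Section TowerSubshift.
Local Open Scope ring_scope.
Variables a b : nat.
Hypotheses (b_gt0 : (0 < b)%N) (le_ba : (b <= a)%N).

Lemma tower_subshiftP (x : full_shift 'I_(a + b).-1.+1) :
  subshift (tower a b) x <-> forall i n, exists k,
    infix [seq val (x (i + j%:Z)) | j <- iota 0 n] (fib_word a b k).
Proof.
have winE i n :
    map val (window x i n) = [seq val (x (i + j%:Z)) | j <- iota 0 n].
  by rewrite -map_comp.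
split=> Xx i n; first by have /tower_languageP := Xx i n; rewrite winE; exact.
by apply/tower_languageP => //; rewrite winE.
Qed.

Lemma tower_subshift_step (x : full_shift 'I_(a + b).-1.+1) i :
  subshift (tower a b) x -> block_step a b (x i) (x (i + 1)).
Proof.
move=> /tower_subshiftP/(_ i 2%N)[k wk].
have := infix_sorted wk (sorted_fib_word b_gt0 le_ba k).
by rewrite /= addr0 andbT.
Qed.
End TowerSubshift.

Section Step.
Local Open Scope ring_scope.
Variables a b : nat.
Hypotheses (b_gt0 : (0 < b)%N) (le_ba : (b <= a)%N).

Let a_gt0 : (0 < a)%N. Proof. lia. Qed.

Local Notation X := (subshift (tower a b)).
Local Notation X' := (subshift (tower (a + b) a)).

Lemma merge_blocks_subshift x : X' x -> X (merge_blocks x).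
Proof.
move=> Xx; apply/tower_subshiftP => // i n.
have /tower_subshiftP/(_ i n)[]// := Xx; first exact: leq_addr.
move=> k /infixP[u [v e]]; exists k.+1; rewrite -map_mod_fib_word // e !map_cat.
rewrite -map_comp [X in infix X](_ : _ = map ((modn^~ (a + b)%N) \o
  (fun j : nat => val (x (i + j%:Z)))) (iota 0 n)) ?infix_infix //.
by apply: eq_map => j; exact: val_merge_blocks.
Qed.

Lemma split_blocksK x : X' x -> split_blocks (merge_blocks x) = x.
Proof.
move=> Xx; apply: funext => i; apply: val_inj; rewrite val_split_blocks //.
rewrite (@decode_modn a b b_gt0 le_ba (fun j => x (i + j%:Z))).
- by rewrite addr0.
- by move=> l _; exact: val_merge_blocks.
- move=> l _; rewrite -[l.+1]addn1 PoszD addrA.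
  by apply: tower_subshift_step => //; exact: leq_addr.
- by apply: ltn_letter => //; exact: leq_addr.
Qed.

Lemma merge_blocksK (z : full_shift 'I_(a + b).-1.+1) :
  merge_blocks (split_blocks z) = z.
Proof.
apply: funext => i; apply: val_inj; rewrite val_merge_blocks //.
rewrite -[nat_of_ord _]/(val _) val_split_blocks // decode_mod ?addr0 //.
by apply: ltn_letter.
Qed.

Lemma split_blocks_subshift z : X z -> X' (split_blocks z).
Proof.
move=> Xz; apply/tower_subshiftP => //; first exact: leq_addr.
(* Decoding looks up to [a] letters ahead, so [n] decoded letters are read off a longer window. *)
move=> i n; have /tower_subshiftP/(_ i (n + a.+1)%N)[]// := Xz.
(* Only words of positive index are reductions of words of the larger tower. *)
move=> k wk; have {wk} := infix_trans wk (infix_fib_wordS b_gt0 le_ba k).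
rewrite -map_mod_fib_word // => /infixP[u [v e]]; exists k.
set w := [seq _ | _ <- iota _ _] in e.
(* The factor of the larger tower lying above the window [w]. *)
pose s := take (size w) (drop (size u) (fib_word (a + b) a k)).
have ws : w = map (modn^~ (a + b)%N) s.
  by rewrite map_take map_drop e drop_size_cat // take_size_cat.
have sw : size s = (n + a.+1)%N.
  by rewrite -(size_map (modn^~ (a + b)%N)) -ws size_map size_iota.
have inf_s : infix s (fib_word (a + b) a k).
  by rewrite (infix_trans (prefixW (prefix_take _ _))) // suffixW ?suffix_drop.
have sorted_s := infix_sorted inf_s (sorted_fib_word a_gt0 (leq_addr _ _) k).
suff -> : [seq val (split_blocks z (i + j%:Z)) | j <- iota 0 n] = take n s.
  exact: infix_trans (prefixW (prefix_take _ _)) inf_s.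
rewrite -(map_nth_iota0 0%N); last by rewrite sw leq_addr.
apply/eq_in_map => j; rewrite mem_iota add0n => /andP[_ ltjn].
rewrite val_split_blocks //.
rewrite (@decode_modn a b b_gt0 le_ba (fun l => nth 0%N s (j + l))).
- by rewrite addn0.
- move=> l lel; have ltjl : (j + l < n + a.+1)%N by lia.
  rewrite -(nth_map 0%N 0%N (modn^~ (a + b)%N)) ?sw // -ws.
  by rewrite (nth_map 0%N) ?size_iota // nth_iota // add0n PoszD addrA.
- move=> l lel; rewrite addnS; apply: (sortedP 0%N sorted_s); rewrite sw; lia.
- rewrite addn0; apply: (@fib_word_lt (a + b) a a_gt0 (leq_addr _ _) k).
  by apply: (mem_infix inf_s); rewrite mem_nth // sw; lia.
Qed.

Lemma tower_conjugate_step :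
  topologically_conjugate (@subshift_map _ (tower (a + b) a))
    (@subshift_map _ (tower a b)).
Proof.
pose f (x : X') : X := exist _ (merge_blocks (val x))
  (mem_set (merge_blocks_subshift (set_mem (valP x)))).
pose g (z : X) : X' := exist _ (split_blocks (val z))
  (mem_set (split_blocks_subshift (set_mem (valP z)))).
exists f; split; last first.
  by move=> x; apply: val_inj.
split.
  apply: continuous_subshift => x i.
  by apply: filterS (near_letter x i) => y e; rewrite /= /merge_blocks e.
exists g; split.
- by move=> x; apply: val_inj; apply: split_blocksK; exact: set_mem (valP x).
- by move=> z; apply: val_inj; apply: merge_blocksK.
apply: continuous_subshift => z i.
(* Once the letter [p] is fixed, the decoded letter depends on only one more coordinate, [a - p]
   places ahead; hence local constancy. *)
pose p := (val z : full_shift _) (i + 0).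
near=> y; rewrite /= /split_blocks /decode; congr inord.
have -> : (val y : full_shift _) (i + 0) = p.
  near: y; exact: near_letter.
have -> // : (val y : full_shift _) (i + (a - p)%N%:Z) =
    (val z : full_shift _) (i + (a - p)%N%:Z).
near: y; exact: near_letter.
Unshelve. all: by end_near.
Qed.

End Step.

(** * Consecutive Fibonacci numbers and the infinite family *)

Definition fib_pair (n : nat) : nat * nat :=
  iter n (fun p => (p.1 + p.2, p.1)) (1, 1).

Lemma fib_pair_bounds n : 0 < (fib_pair n).2 <= (fib_pair n).1.
Proof. by elim: n => //= n; lia. Qed.

Lemma coprime_fib_pair n : coprime (fib_pair n).1 (fib_pair n).2.
Proof. by elim: n => //= n IHn; rewrite coprime_sym /coprime gcdnDl. Qed.

Definition fib_tower (n : nat) := tower (fib_pair n).1 (fib_pair n).2.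

Lemma fib_tower0 : fib_tower 0 = fibonacci.
Proof.
have: subst_fun (fib_tower 0) = subst_fun fibonacci.
  apply: funext => -[[|[]] // i]; apply: (inj_map val_inj);
  by rewrite val_tower.
move: (fib_tower 0) fibonacci => [f fP] [g gP] /= e.
by case: _ / e gP => gP; congr Substitution; exact: Prop_irrelevance.
Qed.

Lemma fib_tower_conjugate n :
  topologically_conjugate (@subshift_map _ (fib_tower n))
    (@subshift_map _ fibonacci).
Proof.
elim: n => [|n]; first by rewrite fib_tower0; exact: conjugate_refl.
apply: conjugate_trans; have /andP[b_gt0 le_ba] := fib_pair_bounds n.
exact: tower_conjugate_step.
Qed.

Lemma fib_pair_sum_lt : {homo (fun n => (fib_pair n).1 + (fib_pair n).2) :
  m n / m < n}.
Proof.
apply: homo_ltn => [? ? ?|n /=]; first exact: ltn_trans.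
by have := fib_pair_bounds n; lia.
Qed.

Theorem theorem5p1 :
  exists (A : nat -> finType) (eta : forall k : nat, substitution (A k)),
    (forall k : nat,
       [/\ primitive_subst (eta k),
           injective_subst (eta k),
           Perron_Frobenius_eigenvalue (incidence_matrix (eta k)) golden_mean
         & topologically_conjugate
             (@subshift_map _ (eta k)) (@subshift_map _ fibonacci)]) /\
    (forall j k : nat, j <> k -> ~ equal_up_to_renaming (eta j) (eta k)).
Proof.
(* The pairs start at [(3, 2)], the first one with second member above 1, as injectivity
   requires. *)
exists _, (fun k => fib_tower k.+2); split=> [k|j k neq_jk [f bij_f _]].
  have /andP[b_gt0 le_ba] := fib_pair_bounds k.+2.
  have cop := coprime_fib_pair k.+2.
  split; [exact: tower_primitive | | exact: tower_Perron_Frobenius |].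
    apply: tower_injective => //=.
    by have := fib_pair_bounds k; lia.
  exact: fib_tower_conjugate.
(* A renaming would equate the alphabet sizes, which strictly increase along the family. *)
have := bij_eq_card bij_f; rewrite !card_ord.
have := fib_pair_bounds j.+2; have := fib_pair_bounds k.+2.
case: (ltngtP j k) neq_jk => // lt_jk _.
  by have := @fib_pair_sum_lt j.+2 k.+2 lt_jk; lia.
by have := @fib_pair_sum_lt k.+2 j.+2 lt_jk; lia.
Qed.
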